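(* Let $G$ be a simple connected signed graph with maximum degree $\Delta(G)$. If $G$ is not a balanced complete graph, a balanced odd circuit, or an unbalanced even circuit, then $\chi(G)\le\Delta(G)$.
   Context: All graphs are finite and nonempty. A signed graph $G$ is a graph in which each edge $e$ is labelled with a sign $\sigma(e)\in\{+1,-1\}$; it is simple if its underlying unsigned graph has no loops and no parallel edges. Graph-theoretic terms such as connected, maximum degree, complete graph and circuit refer to the underlying unsigned graph; a circuit (cycle graph) is odd or even according to its length. A signed graph is balanced if the product of the edge signs on each of its circuits is $+1$, and unbalanced otherwise. A proper colouring of $G$ is a mapping $\phi\colon V(G)\to\mathbb{Z}$ such that for each edge $e=uv$ of $G$ we have $\phi(u)\neq\sigma(e)\phi(v)$. For $n\ge1$ let $M_n=\{\pm1,\pm2,\ldots,\pm k\}$ if $n=2k$, and $M_n=\{0,\pm1,\pm2,\ldots,\pm k\}$ if $n=2k+1$. An $n$-colouring of $G$ is a proper colouring of $G$ using colours from $M_n$. The chromatic number $\chi(G)$ of a signed graph $G$ is the smallest $n\ge 1$ such that $G$ admits an $n$-colouring. *)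

(* Defs.v *)
From mathcomp Require Import all_boot all_order all_algebra.

Set Implicit Arguments.
Unset Strict Implicit.
Unset Printing Implicit Defensive.

Import Order.TTheory GRing.Theory Num.Theory.

(* Simple signed graphs: having an irreflexive symmetric adjacency relation
   rules out loops and parallel edges.  The value of [sign u v] is irrelevant
   when u and v are not adjacent. *)
Record signed_graph := SignedGraph {
  vertex :> finType;
  adj : rel vertex;
  sign : vertex -> vertex -> int;
  vertex_nonempty : (0 < #|vertex|)%N;
  adj_irreflexive : irreflexive adj;
  adj_symmetric : symmetric adj;
  sign_unit : forall u v, adj u v -> sign u v = 1%R \/ sign u v = (-1)%R;
  sign_symmetric : forall u v, adj u v -> sign u v = sign v u
}.

Section SignedGraphs.

Local Open Scope ring_scope.

Variable G : signed_graph.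

Definition connected : Prop := forall u v : G, connect (@adj G) u v.

Definition degree (v : G) : nat := #|[set w | adj v w]|.

Definition max_degree : nat := (\max_(v : G) degree v)%N.

(* A circuit is given by the sequence of its pairwise distinct vertices, in
   cyclic order. *)
Definition circuit (c : seq G) : Prop :=
  (2 < size c)%N /\ ucycle (@adj G) c.

Definition circuit_sign (c : seq G) : int := \prod_(x <- c) sign x (next c x).

Definition balanced : Prop :=
  forall c : seq G, circuit c -> circuit_sign c = 1.

Definition unbalanced : Prop := ~ balanced.

Definition is_complete : Prop := forall u v : G, u != v -> adj u v.

(* G itself is a circuit: some circuit contains all its vertices and edges. *)
Definition is_circuit : Prop :=
  exists c : seq G,
    [/\ circuit c,
        forall v, v \in c
      & forall u v, adj u v -> v = next c u \/ u = next c v].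

(* A circuit has as many edges as vertices. *)
Definition is_odd_circuit : Prop := is_circuit /\ odd #|G|.

Definition is_even_circuit : Prop := is_circuit /\ ~~ odd #|G|.

Definition proper_colouring (phi : G -> int) : bool :=
  [forall u, forall v, adj u v ==> (phi u != sign u v * phi v)].

Definition colours (n : nat) : seq int :=
  (if odd n then [:: 0] else [::])
  ++ [seq k%:Z | k <- iota 1 n./2] ++ [seq - k%:Z | k <- iota 1 n./2].

Definition colourable (n : nat) : bool :=
  [exists phi : {ffun G -> seq_sub (colours n)},
     proper_colouring (fun v => val (phi v))].

Lemma colourableP (n : nat) :
  reflect (exists phi : G -> int,
             proper_colouring phi /\ forall v, phi v \in colours n)
          (colourable n).
Proof.
apply: (iffP existsP) => [[phi phiP]|[phi [phiP phi_in]]].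
  by exists (fun v => val (phi v)); split=> // v; apply: valP.
exists [ffun v => SeqSub (phi_in v)].
apply/forallP => u; apply/forallP => v; rewrite !ffunE /=.
by move/forallP/(_ u)/forallP/(_ v): phiP.
Qed.

Lemma exists_colouring : exists n, (0 < n)%N && colourable n.
Proof.
exists #|G|.*2; rewrite double_gt0 vertex_nonempty; apply/colourableP.
exists (fun v => (enum_rank v).+1%:Z); split.
  apply/forallP => u; apply/forallP => v; apply/implyP => uv.
  apply/eqP => /(congr1 absz); rewrite abszM.
  have -> : `|sign u v|%N = 1%N by case: (sign_unit uv) => ->.
  rewrite mul1n !absz_nat => -[] /val_inj /enum_rank_inj euv.
  by rewrite euv adj_irreflexive in uv.
move=> v; rewrite /colours odd_double doubleK /= mem_cat.
by apply/orP; left; apply/map_f; rewrite mem_iota /= add1n ltnS.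
Qed.

Definition chromatic_number : nat := ex_minn exists_colouring.

End SignedGraphs.

(* Main.v *)
(* Following Zajac's proof of Brooks' theorem.  Let d be the maximum degree.  In
   a connected graph all vertices but a prescribed last one v can be coloured
   greedily with d colours, and v too if its degree is less than d or if two of
   its neighbours forbid the same colour at v.  So assume that G is d-regular.

   Unless G is balanced and complete, some v has neighbours x, y that are
   nonadjacent or span an unbalanced triangle with v.  Extend the path y, v, x
   beyond x to a maximal one.  Its last vertex has all its neighbours on the
   path, hence on a circuit C closed by an edge to the farthest of them.

   If C misses a vertex, colour G - C first and then go around C, choosing the
   first colour so that the last vertex has two neighbours which forbid the same
   colour.  If the path is Hamiltonian and d > 2, colour x and y compatibly; a
   third neighbour of v lies on the rest of the path, which can thus be absorbed
   into v.  If d = 2, then G is a circuit, and a colouring with colours 1 and -1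
   is a potential for the negated signs. *)

Require Import Defs.
From mathcomp Require Import all_boot all_order all_algebra.

Set Implicit Arguments.
Unset Strict Implicit.
Unset Printing Implicit Defensive.

Import Order.TTheory GRing.Theory Num.Theory.
Local Open Scope ring_scope.

(** * Colour sets *)

Lemma size_colours d : size (colours d) = d.
Proof.
rewrite /colours !size_cat !size_map !size_iota addnn -[RHS]odd_double_half.
by case: (odd d).
Qed.

Lemma colours_uniq d : uniq (colours d).
Proof.
have U (g : nat -> int) : injective g -> uniq [seq g k | k <- iota 1 d./2].
  by move=> g_inj; rewrite map_inj_uniq ?iota_uniq.
have P x : x \in [seq k%:Z | k <- iota 1 d./2] -> 0 < x.
  by case/mapP=> k; rewrite mem_iota => /andP[k0 _] ->.
have N x : x \in [seq - k%:Z | k <- iota 1 d./2] -> x < 0.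
  by case/mapP=> k; rewrite mem_iota => /andP[k0 _] ->; rewrite oppr_lt0.
rewrite /colours !cat_uniq !U; last by move=> i j [].
  rewrite /= andbT; apply/and3P; split; first by case: (odd d).
    apply/hasPn => x; rewrite mem_cat; case: (odd d) => //.
    by rewrite inE => /orP[/P|/N]; case: ltgtP.
  by apply/hasPn => x /N x0; apply/negP => /P; rewrite ltNge (ltW x0).
by move=> i j /oppr_inj [].
Qed.

Lemma colours_opp d x : x \in colours d -> - x \in colours d.
Proof.
rewrite /colours !mem_cat => /or3P[|/mapP[k k_in ->]|/mapP[k k_in ->]].
- by case: (odd d) => //; rewrite inE => /eqP ->; rewrite oppr0 inE eqxx.
- by rewrite (map_f (fun k : nat => - k%:Z)) ?orbT.
- by rewrite opprK (map_f (fun k : nat => k%:Z)) ?orbT.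
Qed.

Lemma colours_one d : (1 < d)%N -> 1 \in colours d.
Proof.
move=> d1; rewrite /colours !mem_cat (map_f (fun k : nat => k%:Z)) ?orbT //.
by rewrite mem_iota /= add1n ltnS half_gt0.
Qed.

Lemma free_colour d (s : seq int) :
  (size s < d)%N -> exists2 x, x \in colours d & x \notin s.
Proof.
move=> s_small; apply/hasP; rewrite has_predC; apply/negP => /allP sub.
have := uniq_leq_size (colours_uniq d) sub.
by rewrite size_colours leqNgt s_small.
Qed.

(** * Partial colourings and greedy extension *)

Section PartialColourings.

Context (G : signed_graph) (d : nat).
Implicit Types (u v w x y : G) (T : {set G}) (phi : G -> int).

Definition nbrs v : {set G} := [set w | adj v w].

Lemma sign_sqr u v : adj u v -> sign u v * sign u v = 1.
Proof. by move/sign_unit => [] ->. Qed.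

Lemma sign_colours u v k : adj u v -> k \in colours d -> sign u v * k \in colours d.
Proof.
by move=> uv k_in; case: (sign_unit uv) => ->; rewrite ?mul1r ?mulN1r ?colours_opp.
Qed.

(** A partial colouring is encoded as a total function; [T] is the set of uncoloured vertices, where
    its values are ignored. *)
Definition colours_off T phi : Prop :=
  (forall v, v \notin T -> phi v \in colours d) /\
  (forall u v, u \notin T -> v \notin T -> adj u v -> phi u <> sign u v * phi v).

Lemma colours_off_sub T T' phi :
  T \subset T' -> colours_off T phi -> colours_off T' phi.
Proof.
move=> sT [phi_in phi_ok]; split=> [v|u v] vT => [|uT].
  by apply: phi_in; apply: contra vT; apply: (subsetP sT).
by apply: phi_ok; [apply: contra vT | apply: contra uT]; apply: (subsetP sT).
Qed.

Definition recolour phi v (k : int) : G -> int :=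
  fun w => if w == v then k else phi w.

Lemma recolour_same phi v k : recolour phi v k v = k.
Proof. by rewrite /recolour eqxx. Qed.

Lemma recolour_other phi v k w : w != v -> recolour phi v k w = phi w.
Proof. by rewrite /recolour => /negPf ->. Qed.

(** Edges at [v] need checking only from [v]: signs are symmetric and square to 1, so the constraint
    reads the same from either end. *)
Lemma recolour_off phi T v k :
    k \in colours d -> colours_off T phi ->
    (forall w, w \notin T -> adj v w -> k <> sign v w * phi w) ->
  colours_off (T :\ v) (recolour phi v k).
Proof.
move=> k_in [phi_in phi_ok] k_ok; split=> [w|u w].
  by rewrite !inE /recolour; case: eqP => //= _ /phi_in.
rewrite !inE; case: (eqVneq u v) (eqVneq w v) => [->|uv] [->|wv] /=.
- by rewrite adj_irreflexive.
- by move=> _ wT vw; rewrite recolour_same recolour_other //; apply: k_ok.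
- move=> uT _ vu; rewrite recolour_same recolour_other // => E.
  have uv' : adj v u by rewrite adj_symmetric.
  apply: (k_ok u) => //; rewrite E -sign_symmetric // mulrA.
  by rewrite sign_sqr // mul1r.
- by move=> uT wT; rewrite !recolour_other //; apply: phi_ok.
Qed.

(* [N] represents the constraints on the colour of [v]: two neighbours that
   forbid the same colour need only one representative. *)
Lemma extend_colouring phi T v (N : {set G}) :
    (#|N| < d)%N -> colours_off T phi ->
    (forall w, w \notin T -> adj v w ->
       exists2 w', w' \in N & sign v w * phi w = sign v w' * phi w') ->
  exists k, colours_off (T :\ v) (recolour phi v k).
Proof.
move=> Nd phi_off cover.
have [|k k_in k_free] := @free_colour d [seq sign v w * phi w | w <- enum N].
  by rewrite size_map -cardE.
exists k; apply: recolour_off => // w wT vw; apply/eqP.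
have [w' w'N ->] := cover w wT vw; apply: contra k_free => /eqP ->.
by apply/mapP; exists w'; rewrite ?mem_enum.
Qed.

(* The vertices of [T] other than [v] can be coloured greedily: if [T] is grown
   from [v] along edges, each of them has a neighbour that is coloured later. *)
Definition absorbing v T : Prop :=
  v \in T /\
  forall phi, colours_off T phi -> exists2 phi', colours_off [set v] phi' &
    forall u, u \notin T -> phi' u = phi u.

Hypothesis max_degree_le : forall v, (degree v <= d)%N.

Lemma absorbing_set1 v : absorbing v [set v].
Proof. by split=> [|phi]; [rewrite set11 | exists phi]. Qed.

(** A vertex [w] outside [T] is coloured first, while its neighbour [x] is still uncoloured, so at
    most [d - 1] colours are forbidden. *)
Lemma absorbingU1 v T x w :
  absorbing v T -> x \in T -> adj x w -> absorbing v (w |: T).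
Proof.
move=> [vT abs] xT xw; split=> [|phi phi_off]; first by rewrite inE vT orbT.
case: (boolP (w \in T)) => wT.
  have E : w |: T = T by apply/setUidPr; rewrite sub1set.
  by rewrite E in phi_off *; apply: abs.
have wx : adj w x by rewrite adj_symmetric.
have [||k] := @extend_colouring phi (w |: T) w (nbrs w :\ x) _ phi_off.
- by have := max_degree_le w; rewrite /degree (cardsD1 x) inE wx.
- move=> z zT wz; exists z => //; rewrite !inE wz andbT.
  by apply: contraNneq zT => ->; rewrite inE xT orbT.
rewrite setU1K // => /abs [phi' phi'_off phi'E].
exists phi' => // u; rewrite !inE negb_or => /andP[uw uT].
by rewrite phi'E // recolour_other.
Qed.

Lemma absorbing_path v T x p :
    absorbing v T -> x \in T -> path (@adj G) x p ->
  absorbing v (T :|: [set z in p]).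
Proof.
elim: p x T => [|y p IHp] x T absT xT /=.
  by move=> _; rewrite set_nil setU0.
move=> /andP[xy yp]; rewrite set_cons setUA [T :|: _]setUC.
by apply: (IHp y); rewrite ?setU11 //; apply: (absorbingU1 absT xT).
Qed.

Hypothesis G_connected : connected G.

Lemma absorbing_setT v : absorbing v [set: G].
Proof.
have H (s : seq G) : exists2 T, absorbing v T & {subset s <= T}.
  elim: s => [|w s [T absT sT]]; first by exists [set v]; first exact: absorbing_set1.
  have /connectP[p vp ->] := G_connected v w.
  exists (T :|: [set z in p]).
    by apply: (absorbing_path absT _ vp); case: absT.
  move=> z; rewrite !inE => /predU1P[->|/sT -> //].
  have := mem_last v p; rewrite inE => /predU1P[->|->]; last by rewrite orbT.
  by case: absT => ->.
have [T absT sT] := H (enum G).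
suff <- : T = [set: G] by [].
by apply/setP => z; rewrite inE sT // mem_enum.
Qed.

Lemma colour_off1 v : exists phi, colours_off [set v] phi.
Proof.
(* With every vertex uncoloured any function will do, even 0 where it is not a colour. *)
have [_ /(_ (fun=> 0))] := absorbing_setT v; case=> [|phi phi_off _].
  by split=> u; rewrite inE.
by exists phi.
Qed.

Lemma colours_off0 phi : colours_off set0 phi -> colourable G d.
Proof.
move=> [phi_in phi_ok]; apply/colourableP; exists phi.
split=> [|v]; last by apply: phi_in; rewrite inE.
apply/forallP => u; apply/forallP => v; apply/implyP => uv.
by apply/eqP; apply: phi_ok; rewrite ?inE.
Qed.

Lemma colourable_small_degree v : (degree v < d)%N -> colourable G d.
Proof.
move=> dv; have [phi phi_off] := colour_off1 v.
have [|k] := @extend_colouring phi [set v] v (nbrs v) dv phi_off.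
  by move=> w _ vw; exists w; rewrite ?inE.
by rewrite setDv; apply: colours_off0.
Qed.

(** The extension keeps the colours of [x] and [y], so [y] represents both among the constraints on
    [v], and at most [d - 1] remain. *)
Lemma colourable_absorbing phi v x y T :
    absorbing v T -> colours_off T phi ->
    x != y -> x \notin T -> y \notin T -> adj v x -> adj v y ->
    sign v x * phi x = sign v y * phi y ->
  colourable G d.
Proof.
move=> [_ abs] /abs[phi' phi'_off phi'E] xy xT yT vx vy E.
have [||k] := @extend_colouring phi' [set v] v (nbrs v :\ x) _ phi'_off.
- by have := max_degree_le v; rewrite /degree (cardsD1 x) inE vx.
- move=> w _ vw; case: (eqVneq w x) => [->|wx]; last by exists w; rewrite ?inE ?wx.
  by exists y; rewrite ?inE ?vy ?andbT 1?eq_sym // !phi'E.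
by rewrite setDv; apply: colours_off0.
Qed.

(** * Circuits that miss a vertex *)

Lemma connected_closed (S : {pred G}) x :
  x \in S -> (forall u v, u \in S -> adj u v -> v \in S) -> forall v, v \in S.
Proof.
move=> xS clS v; have /connectP[p xp ->] := G_connected x v.
by elim: p x xS xp => //= y p IHp x xS /andP[xy yp]; apply: (IHp y); first exact: clS xy.
Qed.

(* Walking along the circuit from [x], let [a] be the first vertex with a
   neighbour [u] outside, and [b] its predecessor.  As [b] has no neighbour
   outside, it may be given the colour that constrains [a] just as [u] does;
   the rest of the circuit is then a path ending at [a]. *)
Lemma colourable_cycle x p z :
    uniq (x :: p) -> cycle (@adj G) (x :: p) ->
    {subset nbrs x <= x :: p} -> z \notin x :: p ->
  colourable G d.
Proof.
move=> Uc Cc Nx zc; pose out y := [exists u, adj y u && (u \notin x :: p)].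
have outx : ~~ out x.
  by apply/existsP => -[u /andP[xu]]; rewrite Nx // inE.
have has_out : has out p.
  apply/negPn/negP => /hasPn outp; case/negP: zc.
  apply: (@connected_closed (mem (x :: p)) x) => [|u v uc uv]; first exact: mem_head.
  have : ~~ out u by move: uc; rewrite inE => /predU1P[->|/outp].
  by rewrite negb_exists => /forallP/(_ v); rewrite uv negbK.
have [p1 [a [p2 [Ep outa Nout]]]] :
    exists p1 a p2, [/\ p = rcons p1 a ++ p2, out a & ~~ has out p1].
  have split (o : pred G) : has o p ->
      exists p1 a p2, [/\ p = rcons p1 a ++ p2, o a & ~~ has o p1].
    by case/split_find=> a p1 p2 oa Np1; exists p1, a, p2.
  exact: split.
pose q := belast x p1; pose b := last x p1.
have Ec : x :: p = rcons q b ++ a :: p2.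
  by rewrite -lastI Ep cat_rcons.
have outb : ~~ out b.
  have := mem_last x p1; rewrite inE -/b => /predU1P[->|]; first exact: outx.
  exact: (hasPn Nout).
(* Read the circuit from [a] round to its predecessor [b]; without [b] it is the path to be absorbed
   into [a]. *)
have Cr : cycle (@adj G) (a :: (p2 ++ q) ++ [:: b]).
  by rewrite -catA cats1 -cat_cons -cycle_catC -Ec.
have /andP[Pa ba] : path (@adj G) a (p2 ++ q) && adj b a.
  by move: Cr; rewrite /= rcons_path last_cat /= cat_path => /andP[/andP[-> _] ->].
have Ur : uniq (a :: (p2 ++ q) ++ [:: b]).
  by rewrite -catA cats1 -cat_cons uniq_catC -Ec.
have memc y : (y \in x :: p) = (y \in a :: (p2 ++ q) ++ [:: b]).
  rewrite Ec -[rcons q b]cats1 !(inE, mem_cat).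
  by case: (y == a) (y \in p2) (y \in q) (y == b) => [] [] [] [].
pose C := [set y in x :: p]; pose T := [set a] :|: [set y in p2 ++ q].
have ET : C :\ b = T.
  apply/setP => y; rewrite in_setD1 in_setU in_set1 [y \in C]inE memc !inE mem_cat inE.
  case: eqVneq => [->|_] /=; last by rewrite orbF.
  move: Ur; rewrite -cat_cons cats1 rcons_uniq => /andP[+ _].
  by rewrite inE => /negPf ->.
have [u /andP[au uc]] := existsP outa.
have bC : b \in C by rewrite inE memc inE mem_cat mem_seq1 eqxx !orbT.
(* Only the colours of [phi] off the circuit are kept. *)
have [phi phi_off] := colour_off1 b.
have phiC : colours_off C phi.
  by apply: colours_off_sub phi_off; rewrite sub1set.
have ab : adj a b by rewrite adj_symmetric.
have ub : u != b by apply: contraNneq uc => ->; move: bC; rewrite inE.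
have uC : u \notin C by rewrite inE.
pose k := sign a b * (sign a u * phi u).
have k_in : k \in colours d.
  by do 2![apply: sign_colours => //]; case: phiC => + _; apply.
have := recolour_off (v := b) k_in phiC; rewrite ET => phi1_off.
apply: (@colourable_absorbing (recolour phi b k) a u b T) => //.
- by apply: absorbing_path Pa; rewrite ?set11 //; apply: absorbing_set1.
- apply: phi1_off => w; rewrite inE => wc bw.
  by case/existsP: outb; exists w; rewrite bw.
- by rewrite -ET in_setD1 (negPf uC) andbF.
- by rewrite -ET !inE eqxx.
- by rewrite recolour_same recolour_other // mulrA sign_sqr // mul1r.
Qed.

(** * Maximal paths and degree greater than two *)

Lemma maximal_path s :
    s != [::] -> uniq s -> sorted (@adj G) s ->
  exists t x p, [/\ t ++ s = x :: p, uniq (x :: p), path (@adj G) x p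
    & {subset nbrs x <= x :: p}].
Proof.
(* Induction on the number of vertices off the path, which grows at its front. *)
have [n] := ubnP (#|G| - size s); elim: n s => // n IHn [|x p] // le_n _ Us Ps.
case: (boolP [exists y, adj x y && (y \notin x :: p)]) => [|/existsPn Nx].
  case/existsP=> y /andP[xy yp].
  have Uys : uniq [:: y, x & p] by rewrite cons_uniq yp.
  have lt_s : (size (x :: p) < #|G|)%N.
    by have := max_card (mem [:: y, x & p]); rewrite (card_uniqP Uys).
  have [|||t [z [q [E Uq Pq Nz]]]] := IHn [:: y, x & p] _ _ Uys.
  - by rewrite /= in le_n lt_s *; rewrite -ltnS (leq_trans _ le_n) // ltnS ltn_sub2l.
  - by [].
  - by rewrite /= adj_symmetric xy.
  by exists (rcons t y), z, q; split; rewrite ?cat_rcons.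
exists [::], x, p; split=> // y; rewrite inE => xy.
by have := Nx y; rewrite xy negbK.
Qed.

(** Drop vertices from the far end until the last one is adjacent to [x]; no neighbour of [x] is
    lost. *)
Lemma closing_cycle x p :
    {subset nbrs x <= x :: p} -> nbrs x != set0 ->
    uniq (x :: p) -> path (@adj G) x p ->
  exists q, [/\ {subset q <= p}, uniq (x :: q), cycle (@adj G) (x :: q)
    & {subset nbrs x <= x :: q}].
Proof.
elim/last_ind: p => [|p z IHp] Nx Nx0 Up Pp.
  case/set0Pn: Nx0 => y; move: (Nx y); rewrite inE => + xy.
  by move=> /(_ xy); rewrite inE => /eqP E; rewrite E adj_irreflexive in xy.
have [xz|xz] := boolP (adj x z).
  exists (rcons p z); split=> //.
  by rewrite /= rcons_path Pp last_rcons adj_symmetric.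
have [||||q [sq Uq Cq Nq]] := IHp.
- move=> y y_in; have := Nx y y_in; rewrite !(inE, mem_rcons) => /or3P[-> //|/eqP E|->].
    by move: y_in; rewrite inE E (negPf xz).
  by rewrite orbT.
- by [].
- by move: Up; rewrite -rcons_cons rcons_uniq => /andP[].
- by move: Pp; rewrite rcons_path => /andP[].
by exists q; split=> // y /sq; rewrite mem_rcons inE orbC => ->.
Qed.

(* An unbalanced triangle serves as well as two nonadjacent neighbours of [v]:
   in both cases [x] and [y] can be coloured so as to forbid a single colour
   at [v]. *)
Definition good_triple v x y : Prop :=
  [/\ x != y, adj v x, adj v y
    & ~~ (adj x y && (sign v x * sign x y * sign v y == 1))].

Lemma good_triple_colouring v x y T :
    (1 < d)%N -> good_triple v x y -> ~: [set x; y] \subset T ->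
  exists2 phi, colours_off T phi & sign v x * phi x = sign v y * phi y.
Proof.
(* These colours of [x] and [y] both forbid 1 at [v]; they conflict only if [x] and [y] are adjacent
   and the triangle is balanced. *)
move=> d1 [xy vx vy good] sT; exists (sign v); last by rewrite !sign_sqr.
have inT u : u \notin T -> u = x \/ u = y.
  move=> uT; apply/set2P; rewrite -[_ \in _]negbK -in_setC.
  by apply: contra uT; apply: (subsetP sT).
have bad : adj x y -> sign v x = sign x y * sign v y -> False.
  by move=> adjxy E; case/negP: good; rewrite adjxy -mulrA -E sign_sqr //=.
split=> [u /inT uxy|u w /inT uxy /inT wxy uw].
  by rewrite -[sign v u]mulr1; apply: sign_colours (colours_one d1); case: uxy => ->.
case: uxy wxy uw => -> [] ->; rewrite ?adj_irreflexive // => uw.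
rewrite (sign_symmetric uw) => E; rewrite adj_symmetric in uw.
by apply: bad => //; rewrite E mulrA sign_sqr // mul1r.
Qed.

Lemma colourable_regular v x y :
  (2 < d)%N -> (forall w, degree w = d) -> good_triple v x y -> colourable G d.
Proof.
move=> d2 reg good; have [xy vx vy _] := good.
have vxn : v != x by apply: contraTneq vx => ->; rewrite adj_irreflexive.
have vyn : v != y by apply: contraTneq vy => ->; rewrite adj_irreflexive.
have Us : uniq [:: x; v; y] by rewrite /= !inE negb_or eq_sym vxn xy vyn.
have Ps : sorted (@adj G) [:: x; v; y] by rewrite /= adj_symmetric vx vy.
have [//|t [z [p [E Up Pp Nz]]]] := maximal_path _ Us Ps.
have Nz0 : nbrs z != set0.
  by rewrite -card_gt0; have := reg z; rewrite /degree => ->; apply: ltnW (ltnW d2).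
have [q [sq Uq Cq Nq]] := closing_cycle Nz Nz0 Up Pp.
(* If the path misses [w], so does the circuit [z :: q]; otherwise the path is Hamiltonian. *)
have [/allP all_p|] := boolP (all (mem (x :: z :: p)) (enum G)); last first.
  case/allPn=> w _ wp; apply: (@colourable_cycle z q w) => //.
  apply: contra wp; rewrite !inE => /predU1P[->|/sq ->]; by rewrite ?eqxx ?orbT.
have {}all_p w : w \in t ++ [:: x; v; y].
  have := all_p w; rewrite mem_enum E => /(_ isT); rewrite inE => /predU1P[->|//].
  by rewrite -E mem_cat inE eqxx orbT.
have [w vw wt] : exists2 w, adj v w & w \in t.
  have /card_gt0P[w] : (0 < #|nbrs v :\ x :\ y|)%N.
    have := reg v; rewrite /degree (cardsD1 x) (cardsD1 y) !inE vx vy eq_sym xy /=.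
    by rewrite !add1n => E2; move: d2; rewrite -E2 !ltnS.
  rewrite !inE => /and3P[wy wx vw]; exists w => //.
  have := all_p w; rewrite mem_cat !inE (negPf wy) (negPf wx) orbF /=.
  by case: eqP => [e|_]; [rewrite e adj_irreflexive in vw | rewrite orbF].
have Pt : sorted (@adj G) t.
  have : sorted (@adj G) (t ++ [:: x; v; y]) by rewrite E.
  by case/cat_sorted2.
have Ut : uniq (t ++ [:: x; v; y]) by rewrite E.
case/splitPr: wt Pt Ut all_p E => t1 t2 Pt Ut all_p E.
(* The edge from [v] to [w] gives access to both arms of [t]: [t2] forwards and [t1] backwards. Only
   [x] and [y] stay outside [T]. *)
pose T := [set v; w] :|: [set z in t2] :|: [set z in rev t1].
have absT : absorbing v T.
  have absw : absorbing v [set v; w].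
    by rewrite setUC; apply: absorbingU1 (absorbing_set1 v) _ vw; rewrite set11.
  have /= Pt2 := (cat_sorted2 Pt).2.
  have Pt1 : path (@adj G) w (rev t1).
    have : sorted (@adj G) (rev (rcons t1 w)).
      rewrite rev_sorted; have -> : sorted (fun u => (@adj G)^~ u) =1 sorted (@adj G).
        by case=> //= u l; apply: eq_path => u' u''; rewrite adj_symmetric.
      by move: Pt; rewrite -cat_rcons => /cat_sorted2[].
    by rewrite rev_rcons.
  apply: absorbing_path Pt1; last by rewrite !inE eqxx !orbT.
  by apply: absorbing_path Pt2; last by rewrite !inE eqxx orbT.
have sT : ~: [set x; y] \subset T.
  apply/subsetP => u; have := all_p u; rewrite !(inE, mem_cat, mem_rev).
  by case: (u == x) (u == y) (u == v) (u == w) (u \in t1) (u \in t2) => [] [] [] [] [] [].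
have NT u : u \in [:: x; y] -> u \notin T.
  move=> u_in; move: Ut; rewrite cat_uniq => /and3P[_ /hasPn/(_ u) Nu _].
  have {}Nu : u \notin t1 ++ w :: t2.
    by apply: Nu; move: u_in; rewrite !inE => /orP[] ->; rewrite ?orbT.
  have uv : u != v by move: u_in; rewrite !inE => /orP[] /eqP ->; rewrite eq_sym.
  move: Nu; rewrite !(inE, mem_cat, mem_rev) (negPf uv).
  by case: (u == w) (u \in t1) (u \in t2) => [] [] [].
have [phi phi_off Ephi] := good_triple_colouring (ltnW d2) good sT.
apply: colourable_absorbing absT phi_off xy _ _ vx vy Ephi.
  by apply: NT; rewrite mem_head.
by apply: NT; rewrite !inE eqxx orbT.
Qed.

End PartialColourings.

(** * Potentials, balance and circuits *)

Section Potentials.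

Context (G : signed_graph).
Implicit Types (u v w x y : G) (c : seq G) (f : G -> int) (tau : G -> G -> int).

(** A switching function with values 1 and -1. One for the signs witnesses balance; one for the
    negated signs is a proper colouring, whence the parameter [tau]. *)
Definition potential tau f : Prop :=
  (forall v, f v * f v = 1) /\ (forall u v, adj u v -> tau u v = f u * f v).

(** [next c] permutes the circuit, so each factor [f x] occurs twice and squares to 1. *)
Lemma prod_potential tau f c :
  potential tau f -> circuit c -> \prod_(x <- c) tau x (next c x) = 1.
Proof.
move=> [f_sqr tauE] [_ /andP[Cc Uc]].
have -> : \prod_(x <- c) tau x (next c x) = \prod_(x <- c) (f x * f (next c x)).
  by apply: eq_big_seq => x xc; apply/tauE/next_cycle.
rewrite big_split /= -(big_map (next c) xpredT f).
have perm_next : perm_eq (map (next c) c) c.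
  apply: uniq_perm => // [|x].
    by rewrite map_inj_uniq //; apply: can_inj (prev_next Uc).
  apply/mapP/idP => [[y yc ->]|xc]; first by rewrite mem_next.
  by exists (prev c x); rewrite ?mem_prev ?next_prev.
by rewrite (perm_big _ perm_next) -big_split /= big1.
Qed.

Lemma balanced_potential f : potential (@sign G) f -> balanced G.
Proof. by move=> pot c; apply: prod_potential pot. Qed.

(** Multiplying [tau] along the circuit from its first vertex defines [f]; the total product 1 makes
    it consistent on the closing edge. *)
Lemma potential_circuit tau c :
    uniq c -> cycle (@adj G) c -> (forall v, v \in c) ->
    (forall u v, adj u v -> v = next c u \/ u = next c v) ->
    (forall u v, adj u v -> tau u v * tau u v = 1) ->
    (forall u v, adj u v -> tau u v = tau v u) ->
    \prod_(x <- c) tau x (next c x) = 1 ->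
  exists f, potential tau f.
Proof.
move=> Uc Cc all_c edge_c tau_sqr tau_sym tau_prod.
pose f x := \prod_(y <- take (index x c) c) tau y (next c y).
have f_sqr x : f x * f x = 1.
  by rewrite -big_split big1_seq // => y /= _; apply/tau_sqr/next_cycle.
have f_next x : f (next c x) = f x * tau x (next c x).
  have ltx : (index x c < size c)%N by rewrite index_mem.
  have -> : f x * tau x (next c x) = \prod_(y <- take (index x c).+1 c) tau y (next c y).
    by rewrite (take_nth x) // big_rcons /= nth_index // mulrC.
  rewrite {1}/f; case: (ltnP (index x c).+1 (size c)) => [lt_S|ge_S].
    congr (\prod_(y <- take _ _) _); rewrite next_nth all_c.
    case: c Uc lt_S {all_c edge_c tau_prod f f_sqr ltx Cc} => // a p Uc lt_S.
    by rewrite -[nth a p _]/(nth a (a :: p) (index x (a :: p)).+1) index_uniq.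
  (* From the last vertex [next] returns to the first, where [f] is the empty product. *)
  rewrite [take _.+1 c]take_oversize // tau_prod next_nth all_c.
  case: c ge_S {Uc all_c edge_c tau_prod f f_sqr ltx Cc} => [|a p] ge_S.
    by rewrite big_nil.
  by rewrite nth_default //= eqxx take0 big_nil.
exists f; split=> // u v uv; case: (edge_c _ _ uv) => E.
  by rewrite E f_next -E mulrA f_sqr mul1r.
by rewrite E f_next -E mulrC mulrA f_sqr mul1r tau_sym.
Qed.

(** Otherwise any two neighbours of a vertex are adjacent, which makes the connected graph complete,
    and all triangles are balanced. *)
Lemma exists_good_triple :
  connected G -> ~ (balanced G /\ is_complete G) ->
  exists v x y, good_triple v x y.
Proof.
move=> conG not_bc.
pose good v x y := [&& x != y, adj v x, adj v y
  & ~~ (adj x y && (sign v x * sign x y * sign v y == 1))].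
have [/existsP[v /existsP[x /existsP[y /and4P gd]]]|none] :=
  boolP [exists v, exists x, exists y, good v x y]; first by exists v, x, y.
have triangle v x y : x != y -> adj v x -> adj v y ->
    adj x y /\ sign v x * sign x y * sign v y = 1.
  move=> xy vx vy; move: none; rewrite negb_exists => /forallP/(_ v).
  rewrite negb_exists => /forallP/(_ x); rewrite negb_exists => /forallP/(_ y).
  by rewrite /good xy vx vy /= negbK => /andP[? /eqP].
have complete : is_complete G.
  move=> u w uw; have : w \in [pred w | (w == u) || adj u w].
    apply: (connected_closed conG (x := u)) => [|y z]; first by rewrite inE eqxx.
    rewrite !inE => /predU1P[-> ->|uy yz]; first by rewrite orbT.
    case: (eqVneq z u) => //= zu.
    by have [] := triangle y u z; rewrite // 1?eq_sym // adj_symmetric.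
  by rewrite inE eq_sym (negPf uw).
case: not_bc; split=> //; have /card_gt0P[r _] := vertex_nonempty G.
(* Switch along the star at [r]: since the triangles through [r] are balanced, this is a
   potential. *)
pose f w := if w == r then 1 else sign r w.
apply: (@balanced_potential f); split=> [w|u w uw].
  by rewrite /f; case: eqVneq => [|wr]; rewrite ?mulr1 // sign_sqr // complete // eq_sym.
have nuw : u != w by apply: contraTneq uw => ->; rewrite adj_irreflexive.
rewrite /f; case: (eqVneq u r) nuw uw => [->|ur] nuw uw.
  by rewrite eq_sym (negPf nuw) mul1r.
case: (eqVneq w r) => [e|wr]; first by rewrite mulr1 e sign_symmetric // -e.
have ru : adj r u by rewrite complete // eq_sym.
have rw : adj r w by rewrite complete // eq_sym.
have [_ E] := triangle r u w nuw ru rw.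
rewrite -[LHS]mul1r -(sign_sqr ru) -[LHS]mulr1 -(sign_sqr rw).
by rewrite -[_ * sign u w]mulrA mulrACA E mulr1.
Qed.

Lemma circuit_nbrs c :
    circuit c -> (forall v, degree v = 2) ->
  forall v, v \in c -> nbrs v = [set next c v; prev c v].
Proof.
move=> [sc /andP[Cc Uc]] deg2 v vc; apply/esym/eqP.
rewrite eqEcard [#|nbrs v|]deg2 cards2; apply/andP; split.
  apply/subsetP => w; rewrite !inE => /orP[] /eqP ->; first exact: next_cycle.
  by rewrite adj_symmetric; apply: prev_cycle.
suff -> : next c v != prev c v by [].
(* On at least three vertices, two steps along the circuit cannot return to [v]. *)
apply/eqP => E; have {E} : next c (next c v) = v by rewrite E next_prev.
have [i [|a [|b s]] Es] := rot_to vc; try by move: sc; rewrite -(size_rot i) Es.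
have Us : uniq [:: v, a, b & s] by rewrite -Es rot_uniq.
rewrite -!(next_rot i Uc) Es /= eqxx.
have -> : (a == v) = false by move: Us; rewrite /= !inE eq_sym; case: (a == v).
by rewrite eqxx => E; move: Us; rewrite E /= !inE eqxx orbT.
Qed.

Lemma colourable_two_regular :
    connected G -> (forall v, degree v = 2) ->
    ~ (balanced G /\ is_odd_circuit G) ->
    ~ (unbalanced G /\ is_even_circuit G) ->
  colourable G 2.
Proof.
move=> conG deg2 not_odd not_even.
have /card_gt0P[v _] := vertex_nonempty G.
have [//|//|//|t [x [p [_ Up Pp Nx]]]] := @maximal_path G [:: v].
have Nx0 : nbrs x != set0 by rewrite -card_gt0 [#|_|]deg2.
have [q [_ Uc Cc Nq]] := closing_cycle Nx Nx0 Up Pp.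
pose c := x :: q.
have circ : circuit c.
  split; last by rewrite /ucycle Cc.
  (* Both neighbours of [x] are among the other vertices of the circuit. *)
  suff : (degree x <= size q)%N by rewrite deg2.
  apply: leq_trans (card_size q).
  apply/subset_leq_card/subsetP => y xy; have := Nq y xy; rewrite inE => /predU1P[E|//].
  by move: xy; rewrite E inE adj_irreflexive.
have Nc := circuit_nbrs circ deg2.
have all_c u : u \in c.
  apply: (connected_closed conG (x := x)) => [|y z yc yz]; first exact: mem_head.
  have : z \in nbrs y by rewrite inE.
  by rewrite Nc //; case/set2P=> ->; rewrite ?mem_next ?mem_prev.
have edge_c u w : adj u w -> w = next c u \/ u = next c w.
  move=> uw; have : w \in nbrs u by rewrite inE.
  by rewrite Nc // => /set2P[]; [left | move=> ->; right; rewrite next_prev].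
have is_circ : is_circuit G by exists c.
have size_c : size c = #|G|.
  by rewrite -(card_uniqP Uc); apply: eq_card => u; rewrite all_c.
have csign : circuit_sign c * circuit_sign c = 1.
  rewrite -big_split big1_seq //= => u _.
  by apply: sign_sqr; apply: (@next_cycle G (@adj G) c).
have prodN : \prod_(u <- c) - sign u (next c u) = (-1) ^+ odd #|G| * circuit_sign c.
  rewrite -size_c signr_odd /circuit_sign.
  under eq_bigr do rewrite -mulN1r.
  by rewrite big_split /= big_const_seq count_predT iter_mulr_1.
(* The other sign is excluded: it would make an even circuit unbalanced, and an odd one balanced by
   a potential. *)
have csignE : circuit_sign c = (-1) ^+ odd #|G|.
  case: (boolP (odd #|G|)) => oddG; last first.
    apply/eqP/negPn/negP => c1; apply: not_even; split; last by [].
    by move=> bal; rewrite bal ?eqxx in c1.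
  have /eqP := csign; rewrite -expr2 sqrf_eq1 => /orP[/eqP c1|/eqP //].
  case: not_odd; split=> //.
  have [||f pot] := @potential_circuit (@sign G) c Uc Cc all_c edge_c _ _ c1.
  - exact: sign_sqr.
  - exact: sign_symmetric.
  exact: balanced_potential pot.
(* By [csignE] the negated signs have product 1 around the circuit. *)
have [|||f [f_sqr fE]] := @potential_circuit (fun u w => - sign u w) c Uc Cc all_c edge_c.
- by move=> u w uw; rewrite mulrNN sign_sqr.
- by move=> u w /sign_symmetric ->.
- by rewrite prodN csignE -expr2 sqrr_sign.
have f1 u : f u = 1 \/ f u = -1.
  by have /eqP := f_sqr u; rewrite -expr2 sqrf_eq1 => /orP[] /eqP; auto.
apply/colourableP; exists f; split=> [|u].
  apply/forallP => u; apply/forallP => w; apply/implyP => uw; apply/eqP.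
  have -> : sign u w = - (f u * f w) by rewrite -fE ?opprK.
  by rewrite mulNr -mulrA f_sqr mulr1; case: (f1 u) => ->.
by case: (f1 u) => ->.
Qed.

End Potentials.

Theorem theorem3p1 (G : signed_graph)
    (G_connected : connected G)
    (not_balanced_complete : ~ (balanced G /\ is_complete G))
    (not_balanced_odd_circuit : ~ (balanced G /\ is_odd_circuit G))
    (not_unbalanced_even_circuit : ~ (unbalanced G /\ is_even_circuit G)) :
  (chromatic_number G <= max_degree G)%N.
Proof.
have [v [x [y good]]] := exists_good_triple G_connected not_balanced_complete.
have max_le (w : G) : (degree w <= max_degree G)%N by apply: leq_bigmax.
(* The triple gives [v] two distinct neighbours. *)
have d1 : (1 < max_degree G)%N.
  apply: leq_trans (max_le v); case: good => xy vx vy _.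
  by rewrite /degree (cardsD1 x) (cardsD1 y) !inE vx vy eq_sym xy.
suff col : colourable G (max_degree G).
  by rewrite /chromatic_number; case: ex_minnP => n _; apply; rewrite col ltnW.
have [/existsP[w small]|/existsPn large] :=
  boolP [exists w : G, degree w < max_degree G]%N.
  exact: colourable_small_degree small.
have reg (w : G) : degree w = max_degree G.
  by apply/eqP; rewrite eqn_leq max_le leqNgt large.
case: (ltnP 2 (max_degree G)) => d2; first exact: colourable_regular reg good.
have E2 : max_degree G = 2 by apply/eqP; rewrite eqn_leq d2.
by rewrite E2 in reg *; apply: colourable_two_regular.
Qed.
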